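(* Let $\mathcal{H}$ be an $n$-dimensional Hilbert space, $N\ge n$ and $p>1$. If $(F,G)\in\mathcal{O}_1^p$, then $(F,G)$ is a $1$-uniform $(N,n)$ dual pair for $\mathcal{H}$.
   Context: Hilbert spaces are real or complex and finite-dimensional. A sequence $F=\{f_i\}_{i=1}^N$ in $\mathcal{H}$ is a frame if there are $A,B>0$ with $A\|f\|^2\le\sum_{i=1}^N|\langle f,f_i\rangle|^2\le B\|f\|^2$ for all $f\in\mathcal{H}$. Its analysis operator is $\Theta_F f=(\langle f,f_i\rangle)_{i=1}^N$, with adjoint $\Theta_F^*(c_i)_i=\sum_i c_if_i$. A frame $G=\{g_i\}_{i=1}^N$ is a dual of $F$ if $f=\sum_{i=1}^N\langle f,f_i\rangle g_i$ for all $f\in\mathcal{H}$; then $(F,G)$ is called an $(N,n)$ dual pair. Let $\mathcal{D}^{(1)}$ be the set of $N\times N$ diagonal matrices with exactly one diagonal entry equal to $1$ and all others $0$. With $\|\cdot\|$ the operator norm, define $$\mathcal{O}_1^p(F,G)=\Big\{\frac1N\sum_{D\in\mathcal{D}^{(1)}}\|\Theta_G^*D\Theta_F\|^p\Big\}^{1/p},\qquad \Delta_1^p=\inf\{\mathcal{O}_1^p(F,G):(F,G)\text{ is an }(N,n)\text{ dual pair}\},$$ and let $\mathcal{O}_1^p$ be the set of $(N,n)$ dual pairs $(F,G)$ with $\mathcal{O}_1^p(F,G)=\Delta_1^p$. (Superscript $p$ is an index, not a power.) A dual pair $(F,G)$ is $1$-uniform if there is a constant $c$ with $\langle f_i,g_i\rangle=c$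 for all $1\le i\le N$. *)

(* Defs.v *)
From HB Require Import structures.
From mathcomp Require Import all_boot all_order all_algebra.
From mathcomp Require Import all_classical all_reals all_analysis.

Set Implicit Arguments.
Unset Strict Implicit.
Unset Printing Implicit Defensive.
Import Order.TTheory GRing.Theory Num.Theory.
Local Open Scope classical_set_scope.
Local Open Scope ring_scope.

(* The set D^(1): diagonal matrices with exactly one diagonal entry equal to 1
   and all other entries equal to 0. *)
Definition single_diag (K : numFieldType) (N : nat) : set 'M[K]_N :=
  [set D | is_diag_mx D /\
           exists i, D i i = 1 /\ forall j, j != i -> D j j = 0].
Arguments single_diag : clear implicits.

(* A sum \sum_(D \in A) over a classical set is 0 when its support is infinite;
   the next two facts show that this does not happen for single_diag. *)
Lemma single_diagE (K : numFieldType) (N : nat) :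
  single_diag K N = range (fun i : 'I_N => delta_mx i i).
Proof.
apply/seteqP; split => D /=.
- move=> [/is_diag_mxP dD [i [Di Dj]]]; exists i => //.
  apply/matrixP => a b; rewrite mxE.
  have [->{b}|ab] := eqVneq b a; last first.
    rewrite dD; last by rewrite eq_sym; move: ab; rewrite -val_eqE.
    have [ai|//] := eqVneq a i; by rewrite -ai (negbTE ab).
  have [->|ai] := eqVneq a i; first by rewrite Di.
  by rewrite Dj.
- move=> [i _ <-]; split.
    apply/is_diag_mxP => a b ab; rewrite mxE.
    have [ai|//] := eqVneq a i; have [bi|//] := eqVneq b i.
    by move: ab; rewrite ai bi eqxx.
  exists i; split=> [|j ji]; first by rewrite mxE eqxx.
  by rewrite mxE (negbTE ji).
Qed.

Lemma finite_single_diag (K : numFieldType) (N : nat) :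
  finite_set (single_diag K N).
Proof. by rewrite single_diagE; exact: finite_image. Qed.

(* The real and the complex case are treated at once.  [K] is the scalar field
   and [ip] an inner product on [H], linear in its first argument and
   [theta]-linear in its second one.  The function [re] turns scalars that are
   real numbers, such as [ip f f] or [`|c|], into elements of [R].
   The real case is  K := R, theta := idfun, re := idfun;
   the complex case is  K := R[i], theta := Num.conj, re := complex.Re. *)
Section DualPairs.
Context (R : realType) (K : numFieldType) (re : K -> R) (theta : K -> K).
Context (H : vectType K) (ip : {dot H for theta}).

Definition hnorm (f : H) : R := Num.sqrt (re (ip f f)).

Definition opnorm (T : H -> H) : R :=
  sup [set hnorm (T f) | f in [set f | hnorm f <= 1]].

Section Families.
Context (N : nat).
Implicit Types F G : 'I_N -> H.

Definition is_frame F : Prop :=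
  exists A B : R, [/\ 0 < A, 0 < B &
    forall f : H,
      A * hnorm f ^+ 2 <= \sum_(i < N) re `|ip f (F i)| ^+ 2 /\
      \sum_(i < N) re `|ip f (F i)| ^+ 2 <= B * hnorm f ^+ 2].

Definition analysis F (f : H) : 'cV[K]_N := \col_(i < N) ip f (F i).

Definition synthesis F (c : 'cV[K]_N) : H := \sum_(i < N) c i 0 *: F i.

Definition dual_pair F G : Prop :=
  [/\ is_frame F, is_frame G &
      forall f : H, f = \sum_(i < N) ip f (F i) *: G i].

Definition erasure_error (p : R) F G : R :=
  (N%:R^-1 * \sum_(D \in single_diag K N)
     opnorm (fun f => synthesis G (D *m analysis F f)) `^ p) `^ p^-1.

Definition one_uniform F G : Prop :=
  dual_pair F G /\ exists c : K, forall i, ip (F i) (G i) = c.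

End Families.

Definition optimal_error (N : nat) (p : R) : R :=
  inf [set erasure_error p FG.1 FG.2 |
       FG in [set FG : ('I_N -> H) * ('I_N -> H) | dual_pair FG.1 FG.2]].

Definition optimal_dual_pairs (N : nat) (p : R) :
    set (('I_N -> H) * ('I_N -> H)) :=
  [set FG | dual_pair FG.1 FG.2 /\
            erasure_error p FG.1 FG.2 = optimal_error N p].

End DualPairs.

(* Main.v *)
Require Import Defs.
From HB Require Import structures.
From mathcomp Require Import all_boot all_order all_algebra.
From mathcomp Require Import complex.
From mathcomp Require Import all_classical all_reals all_analysis.
From mathcomp Require Import ring lra.

Set Implicit Arguments.
Unset Strict Implicit.
Unset Printing Implicit Defensive.
Import Order.TTheory GRing.Theory Num.Theory.
Local Open Scope classical_set_scope.
Local Open Scope ring_scope.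

(** The optimal value is [n / N], and it forces every [ip (f i) (g i)] to be
    equal to [n / N].

    Erasing all coefficients but the [i]-th one leaves the rank-one operator
    [f |-> ip f (f i) *: g i], whose operator norm is [a i := |f i| * |g i|]
    ([opnorm_rank_one]).  Hence the error is the [p]-th power mean of the
    [a i] ([erasure_errorE]).

    Lower bound.  The operator of the dual pair is the identity, so the
    [ip (g i) (f i)] sum to its trace [n] ([trace_reconstruction]).  By
    Cauchy-Schwarz [Re (ip (g i) (f i)) <= a i], so the mean of the [a i] is at
    least [n / N].

    Upper bound.  There is a Parseval frame all of whose vectors have squared
    norm [n / N] ([equal_norm_parseval_exists]); paired with itself it has error
    [n / N].  Such a frame comes from an orthonormal basis padded with zeros.
    Whenever two vectors have squared norms on both sides of [n / N], a plane
    rotation of this pair keeps the frame Parseval and can be chosen so that one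
    of the two gets squared norm exactly [n / N].  As the squared norms have
    mean [n / N], such a pair exists as long as some squared norm is wrong, and
    the number of wrong ones drops at each step.

    Equality.  For an optimal pair the [p]-th power mean of the [a i] is at most
    [n / N] while their mean is at least [n / N].  Since [p > 1], strict
    convexity gives [a i = n / N] for all [i] ([powR_mean_rigid]).  Then
    [Re (ip (g i) (f i)) <= n / N] with sum [n] gives equality for each [i], and
    a scalar of modulus at most [n / N] with real part [n / N] is [n / N].

    The real and the complex case are treated together, over a scalar field [K]
    with an embedding [emb] of the reals. *)

(** * Real inequalities *)

Section RealLemmas.
Context (R : realType).

(** The strict Bernoulli inequality, from [x `^ p = x * x `^ (p - 1)], the bound
    [1 + y < expR y] at [y = (p - 1) * ln x], and [x - 1 <= x * ln x]. *)
Lemma powR_bernoulli_lt (p x : R) : 1 < p -> 0 <= x -> x != 1 ->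
  1 + p * (x - 1) < x `^ p.
Proof.
move=> p1; rewrite le_eqVlt => /predU1P[<- _|x0 x1].
  by rewrite powR0; [lra | rewrite gt_eqF//; lra].
have lnx0 : ln x != 0 by rewrite ln_eq0.
have xp : x `^ p = x * x `^ (p - 1).
  rewrite -[in X in _ = X * _](powRr1 (ltW x0)) -powRD ?(gt_eqF x0) ?implybT//.
  by congr (_ `^ _); ring.
have H1 : 1 + (p - 1) * ln x < x `^ (p - 1).
  rewrite /powR gt_eqF//; apply: expR_gt1Dx.
  by rewrite mulf_neq0// gt_eqF//; lra.
have H2 : x - 1 <= x * ln x.
  have := expR_ge1Dx (- ln x); rewrite expRN lnK ?posrE// => H.
  have := ler_wpM2l (ltW x0) H; rewrite mulfV ?gt_eqF//; lra.
rewrite xp; apply: le_lt_trans (_ : x * (1 + (p - 1) * ln x) < _); last first.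
  by rewrite ltr_pM2l.
have p10 : 0 <= p - 1 by lra.
have := ler_wpM2l p10 H2; lra.
Qed.

(** The equality case of the power mean inequality. *)
Lemma powR_mean_rigid (I : finType) (p t : R) (a : I -> R) :
  1 < p -> 0 <= t -> (forall i, 0 <= a i) ->
  #|I|%:R * t <= \sum_i a i -> \sum_i a i `^ p <= #|I|%:R * t `^ p ->
  forall i, a i = t.
Proof.
move=> p1; rewrite le_eqVlt => /predU1P[<- a0 _ + i|t0 a0 ge_sum le_sum i].
  have p0 : p != 0 by rewrite gt_eqF//; lra.
  rewrite powR0// mulr0 => sum_le0.
  have sum0 : \sum_j a j `^ p == 0.
    by rewrite eq_le sum_le0 sumr_ge0// => j _; exact: powR_ge0.
  rewrite psumr_eq0 in sum0; last by move=> j _; exact: powR_ge0.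
  have /= := allP sum0 i (mem_index_enum _).
  by move/eqP/powR_eq0_eq0.
pose y j := a j / t.
have y0 j : 0 <= y j by rewrite divr_ge0// ltW.
have ay j : a j = t * y j by rewrite /y mulrCA mulfV ?mulr1// gt_eqF.
(* These gaps are nonnegative and their sum is at most 0. *)
have gap j : 0 <= y j `^ p - (1 + p * (y j - 1)).
  rewrite subr_ge0; have [->|y1] := eqVneq (y j) 1.
    by rewrite powR1 subrr mulr0 addr0.
  by rewrite ltW// powR_bernoulli_lt.
have sumE : \sum_j (y j `^ p - (1 + p * (y j - 1))) == 0.
  rewrite eq_le sumr_ge0// andbT sumrB big_split/= -mulr_sumr sumrB.
  have -> : \sum_(j : I) (1 : R) = #|I|%:R by rewrite sumr_const.
  have tp0 : 0 < t `^ p by exact: powR_gt0.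
  have L1 : #|I|%:R <= \sum_j y j.
    rewrite -(ler_pM2l t0) mulr_sumr [leLHS]mulrC.
    by under eq_bigr do rewrite -ay.
  have L2 : \sum_j y j `^ p <= #|I|%:R.
    rewrite -(ler_pM2l tp0) mulr_sumr [leRHS]mulrC.
    rewrite (le_trans _ le_sum)// ler_sum// => j _.
    by rewrite ay powRM// ltW.
  have : 0 <= p * (\sum_j y j - #|I|%:R).
    by rewrite mulr_ge0 ?subr_ge0//; lra.
  lra.
rewrite psumr_eq0 in sumE; last by move=> j _; exact: gap.
have /= /eqP gap0 := allP sumE i (mem_index_enum _).
have [y1|y1] := eqVneq (y i) 1; first by rewrite ay y1 mulr1.
by have := powR_bernoulli_lt p1 (y0 i) y1; rewrite -subr_gt0 gap0 ltxx.
Qed.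

(** An indefinite binary quadratic form, with diagonal [a, b] and off-diagonal
    entry [- r], vanishes at some unit vector. *)
Lemma unit_isotropic (a b r : R) : a * b < 0 ->
  exists2 cs : R * R, cs.1 ^+ 2 + cs.2 ^+ 2 = 1 &
    cs.1 ^+ 2 * a - 2 * (cs.1 * cs.2 * r) + cs.2 ^+ 2 * b = 0.
Proof.
move=> ab0; have a0 : a != 0.
  by apply: contraTneq ab0 => ->; rewrite mul0r ltxx.
have D0 : 0 <= r ^+ 2 - a * b by have := sqr_ge0 r; lra.
pose d := Num.sqrt (r ^+ 2 - a * b).
have dE : d ^+ 2 = r ^+ 2 - a * b by rewrite sqr_sqrtr.
(* A root of [a * x ^+ 2 - 2 * r * x + b]; the vector is [(x, 1)]
   normalized. *)
pose x := (r + d) / a.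
have ax : a * x = r + d by rewrite /x mulrCA mulfV ?mulr1.
have x1 : 0 < 1 + x ^+ 2 by have := sqr_ge0 x; lra.
have xE : x ^+ 2 * a - 2 * (x * r) + b = 0.
  apply: (mulfI a0); rewrite mulr0.
  have -> : a * (x ^+ 2 * a - 2 * (x * r) + b) =
            (a * x) ^+ 2 - 2 * (a * x) * r + a * b by ring.
  rewrite ax; have -> : a * b = r ^+ 2 - d ^+ 2 by rewrite dE; ring.
  by ring.
pose s := (Num.sqrt (1 + x ^+ 2))^-1.
have sE : s ^+ 2 * (1 + x ^+ 2) = 1.
  by rewrite exprVn sqr_sqrtr ?(ltW x1)// mulVf ?gt_eqF.
exists (x * s, s) => /=; first by rewrite -sE; ring.
have -> : (x * s) ^+ 2 * a - 2 * (x * s * s * r) + s ^+ 2 * b =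
  s ^+ 2 * (x ^+ 2 * a - 2 * (x * r) + b) by ring.
by rewrite xE mulr0.
Qed.
End RealLemmas.

(** * Real and complex scalars *)

(** [K] with the real part [re], the conjugation [theta] and the embedding [emb]
    of the reals is the field of real or of complex numbers.  The listed
    properties are all that the argument uses; [re] is specified through [emb]. *)
Record real_or_complex (R : realType) (K : numFieldType)
    (re : K -> R) (theta : K -> K) (emb : R -> K) : Prop := RealOrComplex {
  ler_emb : forall r s, (emb r <= emb s) = (r <= s);
  emb_re : forall z, 0 <= z -> emb (re z) = z;
  emb_re_le : forall z, emb (re z) <= `|z|;
  theta_emb : forall r, theta (emb r) = emb r;
  add_theta : forall z, z + theta z = emb (2 * re z);
  mul_theta : forall z, z * theta z = `|z| ^+ 2 }.

Lemma real_scalars (R : realType) :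
  real_or_complex (@idfun R) (@idfun R) (@idfun R).
Proof.
split=> //= [z|z|z].
- exact: ler_norm.
- by rewrite mulr_natl mulr2n.
- by rewrite -expr2 real_normK ?num_real.
Qed.

Lemma complex_scalars (R : realType) :
  real_or_complex (@complex.Re R) (@Num.conj R[i]) (real_complex R).
Proof.
split=> [r s|z z0|z|r|z|z].
- exact: lecR.
- by rewrite RRe_real// ger0_real.
- by rewrite (le_trans _ (normc_ge_Re z))// lecR ler_norm.
- by rewrite conj_Creal//; apply/complex_realP; exists r.
- by rewrite rmorphM rmorph_nat; exact: addcJ.
- by rewrite normCK.
Qed.

(** * Norms and rank-one operators *)

Section InnerProduct.
Context (R : realType) (K : numFieldType) (re : K -> R).
Context (theta : {rmorphism K -> K}) (emb : {rmorphism R -> K}).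
Hypothesis RC : real_or_complex re theta emb.
Context (H : vectType K) (ip : {dot H for theta}).
Implicit Types (u v w f : H) (r s t : R) (z : K).

Local Notation hnorm := (hnorm re ip).

Let emb_inj : injective emb. Proof. exact: fmorph_inj. Qed.

Let emb_ge0 r : (0 <= emb r) = (0 <= r).
Proof. by rewrite -(ler_emb RC) rmorph0. Qed.

Let re_emb r : 0 <= r -> re (emb r) = r.
Proof. by move=> r0; apply: emb_inj; rewrite (emb_re RC)// emb_ge0. Qed.

Let ipDl u v w : ip (u + v) w = ip u w + ip v w.
Proof. exact: linearDl. Qed.
Let ipDr u v w : ip u (v + w) = ip u v + ip u w.
Proof. exact: linearDr. Qed.
Let ipNl u v : ip (- u) v = - ip u v.
Proof. exact: linearNl. Qed.
Let ipNr u v : ip u (- v) = - ip u v.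
Proof. exact: linearNr. Qed.
Let ipZl z u v : ip (z *: u) v = z * ip u v.
Proof. exact: linearZl_LR. Qed.
Let ipZr z u v : ip u (z *: v) = theta z * ip u v.
Proof. exact: linearZr_LR. Qed.
Let ip0l u : ip 0 u = 0. Proof. exact: linear0l. Qed.
Let ip0r u : ip u 0 = 0. Proof. exact: linear0r. Qed.
Let ip_suml I (r : seq I) (P : pred I) (E : I -> H) u :
  ip (\sum_(i <- r | P i) E i) u = \sum_(i <- r | P i) ip (E i) u.
Proof. exact: linear_sumlz. Qed.
Let ipC u v : ip u v = theta (ip v u).
Proof. by rewrite hermC expr0 mul1r. Qed.

Let ip_ge0 u : 0 <= ip u u.
Proof.
by have [->|/(neq0_dnorm_gt0 (s:=ip))/ltW//] := eqVneq u 0; rewrite ip0l.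
Qed.

Let ip_eq0 u : (ip u u == 0) = (u == 0).
Proof.
have [->|u0] := eqVneq u 0; first by rewrite ip0l eqxx.
by rewrite gt_eqF// neq0_dnorm_gt0.
Qed.

Lemma hnorm_ge0 u : 0 <= hnorm u. Proof. exact: sqrtr_ge0. Qed.

Lemma emb_hnorm u : emb (hnorm u ^+ 2) = ip u u.
Proof. by rewrite sqr_sqrtr ?(emb_re RC)// -emb_ge0 (emb_re RC). Qed.

Lemma hnorm_eq0 u : (hnorm u == 0) = (u == 0).
Proof. by rewrite -ip_eq0 -emb_hnorm rmorphXn sqrf_eq0 fmorph_eq0. Qed.

Lemma emb_norm r : 0 <= r -> `|emb r| = emb r.
Proof. by move=> r0; rewrite ger0_norm// emb_ge0. Qed.

Lemma hnormZ z u : hnorm (z *: u) = re `|z| * hnorm u.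
Proof.
have rz0 : 0 <= re `|z| by rewrite -emb_ge0 (emb_re RC).
apply/eqP; rewrite -(@eqrXn2 _ 2%N) ?hnorm_ge0 ?mulr_ge0 ?hnorm_ge0//.
apply/eqP/emb_inj; rewrite emb_hnorm exprMn rmorphM/= emb_hnorm rmorphXn/=.
by rewrite (emb_re RC)// ipZl ipZr mulrA (mul_theta RC).
Qed.

(** The squared norm of [ip v v *: u - ip u v *: v] is nonnegative. *)
Lemma cauchy_schwarz u v : `|ip u v| <= emb (hnorm u * hnorm v).
Proof.
rewrite -(@ler_pXn2r _ 2%N) ?nnegrE ?emb_ge0 ?mulr_ge0 ?hnorm_ge0//.
rewrite -rmorphXn/= exprMn rmorphM/= !emb_hnorm -(mul_theta RC).
have [->|v0] := eqVneq v 0; first by rewrite ip0l ip0r mul0r mulr0.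
have vv0 : 0 < ip v v by rewrite neq0_dnorm_gt0.
have := ip_ge0 (ip v v *: u - ip u v *: v).
rewrite !(ipDl, ipDr, ipNl, ipNr, ipZl, ipZr) -(ipC v v) (ipC v u).
set a := ip u v; set d := ip v v; set c := ip u u => L.
rewrite -subr_ge0 -(pmulr_rge0 _ vv0) -/d.
by apply: le_trans L _; rewrite le_eqVlt; apply/orP; left; apply/eqP; ring.
Qed.

Lemma opnorm_rank_one u v :
  opnorm re ip (fun f => ip f u *: v) = hnorm u * hnorm v.
Proof.
pose E := [set hnorm (ip f u *: v) | f in [set f | hnorm f <= 1]].
have le_E : ubound E (hnorm u * hnorm v).
  move=> _ [f /= f1 <-]; rewrite hnormZ ler_wpM2r ?hnorm_ge0//.
  rewrite -(ler_emb RC) (emb_re RC)// (le_trans (cauchy_schwarz f u))//.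
  by rewrite (ler_emb RC) ler_piMl ?hnorm_ge0.
apply/le_anti/andP; split.
  apply: ge_sup => //; exists (hnorm (ip 0 u *: v)), 0 => //=.
  by rewrite (eqP (_ : hnorm 0 == 0)) ?hnorm_eq0.
apply: ub_le_sup; first by exists (hnorm u * hnorm v).
have [->|u0] := eqVneq u 0.
  exists 0; rewrite /= ?ip0l ?scale0r; last first.
    by rewrite (eqP (_ : hnorm 0 == 0)) ?mul0r ?hnorm_eq0.
  by rewrite (eqP (_ : hnorm 0 == 0)) ?hnorm_eq0.
have nu0 : hnorm u != 0 by rewrite hnorm_eq0.
have iu0 : 0 <= (hnorm u)^-1 by rewrite invr_ge0 hnorm_ge0.
(* The supremum is attained at the normalization of [u]. *)
exists (emb (hnorm u)^-1 *: u) => /=.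
  by rewrite hnormZ emb_norm// re_emb// mulVf.
rewrite ipZl hnormZ -emb_hnorm -rmorphM/= expr2 mulrA mulVf// mul1r.
by rewrite emb_norm ?re_emb ?hnorm_ge0.
Qed.

(** The synthesis of a masked coefficient vector is the rank-one operator
    [f |-> ip f (F i) *: G i]. *)
Lemma erasure_errorE N (p : R) (F G : 'I_N -> H) :
  erasure_error re ip p F G =
  (N%:R^-1 * \sum_i (hnorm (F i) * hnorm (G i)) `^ p) `^ p^-1.
Proof.
rewrite /erasure_error; congr ((_ * _) `^ _).
rewrite single_diagE fsbig_image; last first.
  move=> i j _ _ /matrixP/(_ i i); rewrite !mxE eqxx andbb /=.
  by have [//|_] := eqVneq i j; move/eqP; rewrite oner_eq0.
rewrite (@fsbigE _ _ _ _ _ (enum 'I_N)) ?enum_uniq//; last first.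
  by move=> i _; rewrite mem_enum.
rewrite big_enum_cond/=; apply: eq_big => [i|i _]; first by rewrite in_setT.
congr (_ `^ _); rewrite -opnorm_rank_one; congr opnorm.
apply/funext => f; rewrite /synthesis (bigD1 i)//= big1 ?addr0.
  congr (_ *: _); rewrite mxE (bigD1 i)//= big1 ?addr0 ?mxE ?eqxx ?mul1r//.
  by move=> j /negbTE ji; rewrite !mxE ji andbF mul0r.
move=> j /negbTE ji; rewrite mxE big1 ?scale0r// => k _.
by rewrite !mxE ji mul0r.
Qed.

(** * Orthonormal bases and the trace *)

(** A finite family of pairwise orthogonal unit vectors, not necessarily
    spanning. *)
Definition orthonormal_family k (e : 'I_k -> H) :=
  forall i j, ip (e i) (e j) = (i == j)%:R.

(** The identity of a dual pair, without the frame inequalities.  With [G = F] it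
    says that [F] is a Parseval frame, and that an orthonormal family is a
    basis. *)
Definition reconstruction k (F G : 'I_k -> H) :=
  forall f, f = \sum_i ip f (F i) *: G i.

Lemma orthonormal_family_coord k (e : 'I_k -> H) (a : 'I_k -> K) j :
  orthonormal_family e -> ip (\sum_i a i *: e i) (e j) = a j.
Proof.
move=> on; rewrite ip_suml (bigD1 j)//= big1 ?addr0 => [|i /negbTE ij].
  by rewrite ipZl on eqxx mulr1.
by rewrite ipZl on ij mulr0.
Qed.

Lemma orthonormal_family_free k (e : 'I_k -> H) :
  orthonormal_family e -> free [tuple e i | i < k].
Proof.
move=> on; apply/freeP => a a0 j; rewrite -(orthonormal_family_coord a j on).
suff -> : \sum_i a i *: e i = 0 by rewrite ip0l.
by rewrite -[RHS]a0; apply: eq_bigr => i _; rewrite -tnth_nth tnth_mktuple.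
Qed.

(** One step of the Gram-Schmidt process, from a vector which is not equal to its
    projection. *)
Lemma orthonormal_family_extend k (e : 'I_k -> H) :
  orthonormal_family e -> ~ reconstruction e e ->
  exists e' : 'I_k.+1 -> H, orthonormal_family e'.
Proof.
move=> on /existsNP[f /eqP f_neq].
pose w := f - \sum_i ip f (e i) *: e i.
have w0 : w != 0 by rewrite subr_eq0.
have we j : ip w (e j) = 0.
  by rewrite ipDl ipNl (orthonormal_family_coord _ _ on) subrr.
pose g := emb (hnorm w)^-1 *: w.
have gg : ip g g = 1.
  rewrite ipZl ipZr (theta_emb RC) -emb_hnorm -!rmorphM/=.
  by rewrite expr2 mulrA mulrACA mulVf ?hnorm_eq0// mulr1 rmorph1.
have ge j : ip g (e j) = 0 by rewrite ipZl we mulr0.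
pose e' (i : 'I_k.+1) := oapp e g (unlift ord0 i).
exists e' => i j; rewrite /e'.
case: (unliftP ord0 i) => [i'|] ->; case: (unliftP ord0 j) => [j'|] ->;
  rewrite ?liftK ?unlift_none /=.
- by rewrite on (inj_eq lift_inj).
- by rewrite ipC ge rmorph0.
- by rewrite ge.
- by rewrite gg.
Qed.

Lemma orthonormal_basis_exists : exists e : 'I_(\dim {:H}) -> H,
  orthonormal_family e /\ reconstruction e e.
Proof.
have bound k (e : 'I_k -> H) : orthonormal_family e -> (k <= \dim {:H})%N.
  move=> /orthonormal_family_free; rewrite /free size_tuple => /eqP <-.
  exact: dimvS (subvf _).
suff [k [e [on rec]]] : exists k (e : 'I_k -> H),
    orthonormal_family e /\ reconstruction e e.
  have kE : \dim {:H} = k.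
    apply: (@size_basis _ _ _ _ [tuple e i | i < k]).
    rewrite basisEdim size_tuple (bound _ _ on) andbT; apply/subvP => f _.
    rewrite (rec f); apply: rpred_sum => i _; apply/rpredZ/memv_span.
    by rewrite -(tnth_mktuple e i) mem_tnth.
  by rewrite kE; exists e.
(* The empty family is extended until it spans, by induction on the defect. *)
have : exists e : 'I_0 -> H, orthonormal_family e by exists (fun=> 0) => -[].
move: (leq_subr 0 (\dim {:H})); move: {2}(\dim {:H}) => m.
elim: m 0%N => [|m IH] k.
  rewrite leqn0 subn_eq0 => dk [e on].
  exists k, e; split=> //; apply: contrapT => /(orthonormal_family_extend on)[e'].
  by move/bound; rewrite ltnNge dk.
move=> dk [e on].
have [rec|/(orthonormal_family_extend on)] := pselect (reconstruction e e).
  by exists k, e.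
by apply: IH; move: dk; rewrite subnS; case: (_ - k)%N.
Qed.

Lemma ip_reconstruction k (F G : 'I_k -> H) f g :
  reconstruction F G -> ip f g = \sum_i ip f (F i) * ip (G i) g.
Proof.
move=> /(_ f) {1}->; rewrite ip_suml; apply: eq_bigr => i _.
by rewrite ipZl.
Qed.

(** The trace of the identity, computed in an orthonormal basis. *)
Lemma trace_reconstruction N (F G : 'I_N -> H) :
  reconstruction F G -> \sum_i ip (G i) (F i) = (\dim {:H})%:R.
Proof.
move=> FG; have [e [on ee]] := orthonormal_basis_exists.
under eq_bigr do rewrite (ip_reconstruction _ _ ee).
rewrite exchange_big/=.
under eq_bigr => k _ do under eq_bigr do rewrite mulrC.
under eq_bigr => k _ do rewrite -(ip_reconstruction _ _ FG) on eqxx.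
by rewrite sumr_const card_ord.
Qed.

(** A Parseval frame satisfies the frame inequalities with both bounds 1. *)
Lemma reconstruction_dual_pair N (F : 'I_N -> H) :
  reconstruction F F -> dual_pair re ip F F.
Proof.
move=> FF; suff frame : is_frame re ip F by split.
exists 1, 1; split=> // f; rewrite mul1r.
suff -> : hnorm f ^+ 2 = \sum_i re `|ip f (F i)| ^+ 2 by split.
apply: emb_inj; rewrite emb_hnorm (ip_reconstruction _ _ FF) rmorph_sum/=.
apply: eq_bigr => i _.
by rewrite rmorphXn/= (emb_re RC)// -(mul_theta RC) -ipC.
Qed.

(** * Parseval frames of vectors of equal norm *)

(** An orthonormal basis padded with zero vectors. *)
Lemma parseval_exists N : (\dim {:H} <= N)%N ->
  exists F : 'I_N -> H, reconstruction F F.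
Proof.
move=> dN; have [e [on ee]] := orthonormal_basis_exists.
pose E (j : nat) := oapp e 0 (insub j).
exists (fun i => E i) => f; rewrite {1}(ee f).
pose T j := ip f (E j) *: E j.
transitivity (\sum_(i < \dim {:H}) T i).
  by apply: eq_bigr => i _; rewrite /T /E valK.
rewrite (big_ord_widen _ _ dN) big_mkcond/=; apply: eq_bigr => i _.
case: ifPn => // di; rewrite /T /E insubF ?ip0r ?scale0r//.
exact: negbTE.
Qed.

(** The family [F] with its [i]-th and [j]-th vectors combined by the matrix of
    rows [(c, - s)] and [(s, c)], which is a rotation when [c ^+ 2 + s ^+ 2 = 1]. *)
Definition pair_rotation N (c s : R) (i j : 'I_N) (F : 'I_N -> H) : 'I_N -> H :=
  fun k => if k == i then emb c *: F i - emb s *: F j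
           else if k == j then emb s *: F i + emb c *: F j else F k.

Lemma reconstruction_pair_rotation N c s (i j : 'I_N) (F : 'I_N -> H) :
  i != j -> c ^+ 2 + s ^+ 2 = 1 ->
  reconstruction F F ->
  reconstruction (pair_rotation c s i j F) (pair_rotation c s i j F).
Proof.
move=> ij cs FF f; rewrite {1}(FF f) /pair_rotation.
rewrite (bigD1 i)//= (bigD1 j) 1?eq_sym//=.
rewrite [RHS](bigD1 i)//= [in RHS](bigD1 j) 1?eq_sym//= !addrA eqxx.
rewrite eq_sym (negbTE ij) eqxx; congr (_ + _); last first.
  by apply: eq_bigr => k /andP[/negbTE -> /negbTE ->].
rewrite !(ipDr, ipNr, ipZr, theta_emb RC).
set a := ip f (F i); set b := ip f (F j).
have cs1 : emb c ^+ 2 + emb s ^+ 2 = 1.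
  by rewrite -!rmorphXn/= -rmorphD/= cs rmorph1.
rewrite !scalerDr !scalerN !scalerA.
have -> : a *: F i + b *: F j =
  ((emb c * a - emb s * b) * emb c + (emb s * a + emb c * b) * emb s) *: F i +
  ((emb s * a + emb c * b) * emb c - (emb c * a - emb s * b) * emb s) *: F j.
  by congr (_ *: _ + _ *: _); rewrite -[LHS]mul1r -cs1; ring.
rewrite !scalerDl !scaleNr.
by rewrite [X in _ + X = _]addrC addrACA.
Qed.

Lemma pair_rotation_hnorm N c s (i j : 'I_N) (F : 'I_N -> H) :
  hnorm (pair_rotation c s i j F i) ^+ 2 =
  c ^+ 2 * hnorm (F i) ^+ 2 - 2 * (c * s * re (ip (F i) (F j))) +
  s ^+ 2 * hnorm (F j) ^+ 2.
Proof.
apply: emb_inj; rewrite emb_hnorm /pair_rotation eqxx.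
rewrite !(ipDr, ipDl, ipNr, ipNl, ipZr, ipZl, theta_emb RC).
rewrite rmorphD rmorphB (rmorphM emb (c ^+ 2)) (rmorphM emb (s ^+ 2))/=.
rewrite !emb_hnorm !rmorphM/= rmorph_nat.
have := add_theta RC (ip (F i) (F j)); rewrite -ipC rmorphM rmorph_nat/=.
set a := ip (F i) (F j); set b := ip (F j) (F i) => ab.
have -> : 2 * (emb c * emb s * emb (re a)) =
  emb c * emb s * (a + b) by rewrite ab; ring.
ring.
Qed.

Lemma equal_norm_parseval_exists N : (\dim {:H} <= N)%N ->
  exists F : 'I_N -> H, reconstruction F F /\
    forall i, hnorm (F i) ^+ 2 = (\dim {:H})%:R / N%:R.
Proof.
case: N => [|N].
  by move=> /parseval_exists[F FF]; exists F; split=> // -[].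
move=> dN; pose t : R := (\dim {:H})%:R / N.+1%:R.
pose bad (F : 'I_N.+1 -> H) := [set i | hnorm (F i) ^+ 2 != t]%SET.
suff IH m (F : 'I_N.+1 -> H) : (#|bad F| <= m)%N -> reconstruction F F ->
    exists F' : 'I_N.+1 -> H, reconstruction F' F' /\
      forall i, hnorm (F' i) ^+ 2 = t.
  by have [F FF] := parseval_exists dN; exact: (IH #|bad F| F).
elim: m F => [|m IH] F badF FF.
  exists F; split=> // i; apply/eqP; apply: contraTT badF => bi.
  by rewrite -ltnNge card_gt0; apply/set0Pn; exists i; rewrite inE.
have [bad0|[k]] := set_0Vmem (bad F).
  by apply: IH FF; rewrite bad0 cards0.
rewrite inE => bk.
pose d i := hnorm (F i) ^+ 2 - t.
have dk : d k != 0 by rewrite subr_eq0.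
have sumd : \sum_i d i = 0.
  rewrite sumrB sumr_const card_ord -mulr_natr divfK ?pnatr_eq0//.
  apply/eqP; rewrite subr_eq0; apply/eqP/emb_inj; rewrite rmorph_sum/=.
  under eq_bigr do rewrite emb_hnorm.
  by rewrite trace_reconstruction// rmorph_nat.
(* The deviations [d] have sum 0 and do not all vanish. *)
have [i di] : exists i, d i < 0.
  apply/existsP; apply: contraNT dk; rewrite negb_exists => /forallP dge.
  have /eqP := sumd; rewrite psumr_eq0; last by move=> i _; rewrite leNgt.
  by move/allP/(_ k (mem_index_enum _)).
have [j dj] : exists j, 0 < d j.
  apply/existsP; apply: contraNT dk; rewrite negb_exists => /forallP dle.
  have : \sum_i - d i == 0 by rewrite sumrN sumd oppr0.
  rewrite psumr_eq0; last by move=> l _; rewrite oppr_ge0 leNgt.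
  by move/allP/(_ k (mem_index_enum _)); rewrite oppr_eq0.
have ij : i != j by apply: contraTneq di => ->; rewrite -leNgt ltW.
have dij : d i * d j < 0 by rewrite nmulr_rlt0.
have [[c s] /= cs1 csd] := unit_isotropic (re (ip (F i) (F j))) dij.
apply: (IH (pair_rotation c s i j F)); last first.
  exact: reconstruction_pair_rotation.
(* The index [j] was bad before the rotation, and [i] no longer is after it. *)
rewrite -ltnS; apply: leq_trans badF; apply/proper_card/properP; split.
  apply/fintype.subsetP => l; rewrite !inE /pair_rotation.
  have [->|li] := eqVneq l i; first by move=> _; rewrite -subr_eq0 lt_eqF.
  by have [-> _|//] := eqVneq l j; rewrite -subr_eq0 gt_eqF.
exists i; first by rewrite inE -subr_eq0 lt_eqF.
rewrite inE negbK pair_rotation_hnorm; apply/eqP.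
have -> : t = (c ^+ 2 + s ^+ 2) * t by rewrite cs1 mul1r.
apply/eqP; rewrite -subr_eq0 -csd /d; apply/eqP; ring.
Qed.

(** * Optimal dual pairs *)

Lemma optimal_error_le N (p : R) : (\dim {:H} <= N)%N -> (0 < N)%N -> 1 < p ->
  optimal_error re ip N p <= (\dim {:H})%:R / N%:R.
Proof.
move=> dN N0 p1; have [F [FF Ft]] := equal_norm_parseval_exists dN.
set t := _ / _ in Ft *.
have t0 : 0 <= t by rewrite divr_ge0.
have p0 : p != 0 by rewrite gt_eqF//; lra.
have <- : erasure_error re ip p F F = t.
  rewrite erasure_errorE; under eq_bigr do rewrite -expr2 Ft.
  rewrite sumr_const card_ord -(mulr_natl (t `^ p)) mulKf ?pnatr_eq0 -?lt0n//.
  by rewrite -powRrM mulfV// powRr1.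
apply: ge_inf; last by exists (F, F) => //; exact: reconstruction_dual_pair.
by exists 0 => _ [FG _ <-]; exact: powR_ge0.
Qed.

Lemma optimal_one_uniform N (p : R) (F G : 'I_N -> H) :
  (\dim {:H} <= N)%N -> 1 < p -> optimal_dual_pairs re ip p (F, G) ->
  one_uniform re ip F G.
Proof.
case: N F G => [|N] F G dN p1 [/= FG opt]; split=> //.
  by exists 0 => -[].
have [_ _ rec] := FG.
pose t : R := (\dim {:H})%:R / N.+1%:R.
have Nt : N.+1%:R * t = (\dim {:H})%:R by rewrite mulrC divfK ?pnatr_eq0.
pose a i := hnorm (F i) * hnorm (G i); pose z i := ip (G i) (F i).
have t0 : 0 <= t by rewrite divr_ge0.
have a0 i : 0 <= a i by rewrite mulr_ge0 ?hnorm_ge0.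
have za i : `|z i| <= emb (a i) by rewrite /a mulrC; exact: cauchy_schwarz.
have rea i : re (z i) <= a i.
  by rewrite -(ler_emb RC) (le_trans (emb_re_le RC _)).
(* The real parts are summed through [z + theta z]. *)
have sumz : \sum_i re (z i) = N.+1%:R * t.
  apply: (mulfI (_ : 2 != 0)) => //; apply: emb_inj.
  rewrite mulr_sumr rmorph_sum/= Nt.
  under eq_bigr do rewrite -(add_theta RC).
  rewrite big_split/= -rmorph_sum/= trace_reconstruction//.
  by rewrite rmorph_nat rmorphM/= !rmorph_nat -mulr2n mulr_natl.
have p0 : 0 < p by lra.
have suma : \sum_i a i `^ p <= N.+1%:R * t `^ p.
  have := optimal_error_le dN (ltn0Sn N) p1; rewrite -opt erasure_errorE.
  rewrite -/t => le_t; rewrite -ler_pdivrMl ?ltr0n//.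
  set S := _ * _ in le_t *.
  have S0 : 0 <= S.
    by rewrite mulr_ge0 ?invr_ge0// sumr_ge0// => i _; exact: powR_ge0.
  have := ge0_ler_powR (ltW p0) _ _ le_t; rewrite !nnegrE powR_ge0 => /(_ isT t0).
  by rewrite -powRrM mulVf ?gt_eqF// powRr1.
have aE : forall i, a i = t.
  apply: powR_mean_rigid p1 t0 a0 _ _; rewrite card_ord//.
  by rewrite -sumz ler_sum.
have ret i : re (z i) = t.
  have ge0 j : 0 <= t - re (z j) by rewrite subr_ge0 -(aE j).
  have : \sum_j (t - re (z j)) == 0.
    by rewrite sumrB sumz sumr_const card_ord mulr_natl subrr.
  rewrite psumr_eq0// => /allP/(_ i (mem_index_enum _))/=.
  by rewrite subr_eq0 => /eqP.
(* A scalar [z] with [z + theta z = 2 * t] and [z * theta z = t ^+ 2] is a root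
   of [('X - t) ^+ 2]. *)
have zt i : z i = emb t.
  have nz : `|z i| = emb t.
    apply/le_anti; rewrite -{1}(aE i) za/= -(ret i); exact: (emb_re_le RC).
  have := mul_theta RC (z i); have := add_theta RC (z i).
  rewrite ret nz rmorphM rmorph_nat/= => sumE prodE.
  apply/eqP; rewrite -subr_eq0 -sqrf_eq0; apply/eqP.
  have thE : theta (z i) = 2 * emb t - z i by rewrite -sumE; ring.
  rewrite thE in prodE.
  have -> : (z i - emb t) ^+ 2 = emb t ^+ 2 - z i * (2 * emb t - z i) by ring.
  by rewrite prodE subrr.
by exists (emb t) => i; rewrite ipC -/(z i) zt (theta_emb RC).
Qed.
End InnerProduct.

Theorem theorem4p2 (R : realType) (n N : nat) (p : R)
    (nN : (n <= N)%N) (p1 : 1 < p) :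
  (forall (H : vectType R) (ip : {dot H for (@idfun R)}),
     \dim {:H} = n ->
     forall F G : 'I_N -> H,
       optimal_dual_pairs (@idfun R) ip p (F, G) ->
       one_uniform (@idfun R) ip F G) /\
  (forall (H : vectType R[i]) (ip : {dot H for (@Num.conj R[i])}),
     \dim {:H} = n ->
     forall F G : 'I_N -> H,
       optimal_dual_pairs (@complex.Re R) ip p (F, G) ->
       one_uniform (@complex.Re R) ip F G).
Proof.
split=> H ip dimH F G; apply: optimal_one_uniform => //; rewrite ?dimH//.
- exact: real_scalars.
- exact: complex_scalars.
Qed.
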